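(* Let $(A,[-,-],\varepsilon)$ be a Lie color algebra. Define the even trilinear map $[-,-,-]:A\otimes A\otimes A\to A$ by $$[x,y,z]:=[x,[y,z]]$$ for $x,y,z\in\mathcal{H}(A)$. Then $(A,[-,-,-],\varepsilon)$ is a color Lie triple system.
   Context: $\mathbb{K}$ is a field of characteristic different from 2 and $G$ is an abelian group. A bicharacter is a map $\varepsilon:G\times G\to\mathbb{K}^*$ with $\varepsilon(a,b)\varepsilon(b,a)=1$, $\varepsilon(a,b+c)=\varepsilon(a,b)\varepsilon(a,c)$, $\varepsilon(a+b,c)=\varepsilon(a,c)\varepsilon(b,c)$. For a $G$-graded vector space $V=\bigoplus_{a\in G}V_a$ over $\mathbb{K}$, $\mathcal{H}(V)$ denotes the set of homogeneous elements. For homogeneous $x,y,z$ one writes $\varepsilon(x,y)$ for $\varepsilon(\deg x,\deg y)$, $\varepsilon(x,y+z)$ for $\varepsilon(\deg x,\deg y+\deg z)$, etc. A multilinear map is even if the degree of its value on homogeneous elements is the sum of their degrees. A Lie color algebra is a triple $(A,[-,-],\varepsilon)$ with $A$ a $G$-graded vector space, $[-,-]:A\otimes A\to A$ even bilinear and $\varepsilon$ a bicharacter, such that for all $x,y,z\in\mathcal{H}(A)$: $[x,y]=-\varepsilon(x,y)[y,x]$ and $\varepsilon(z,x)[x,[y,z]]+\varepsilon(x,y)[y,[z,x]]+\varepsilon(y,z)[z,[x,y]]=0$. A color Lie triple system is a $G$-graded vector space $A$ with a bicharacter $\varepsilon$ and an even trilinear map $[-,-,-]:A\otimes A\otimes A\to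 A$ such that for all $x,y,z,t,u\in\mathcal{H}(A)$: (i) $[[x,y,z],t,u]=[x,y,[z,t,u]]+\varepsilon(z,t+u)[x,[y,t,u],z]+\varepsilon(y+z,t+u)[[x,t,u],y,z]$; (ii) $[x,y,z]=-\varepsilon(y,z)[x,z,y]$; (iii) $\varepsilon(z,x)[x,y,z]+\varepsilon(x,y)[y,z,x]+\varepsilon(y,z)[z,x,y]=0$. *)

(* Defs.v *)
From HB Require Import structures.
From mathcomp Require Import all_boot all_order all_algebra.

Set Implicit Arguments.
Unset Strict Implicit.
Unset Printing Implicit Defensive.

Import GRing.Theory.
Local Open Scope ring_scope.

(* Internal direct sum decomposition of V indexed by G. Since G and V may be
   infinite, both clauses are stated over finite sequences of degrees. *)
Record grading (K : fieldType) (G : zmodType) (V : lmodType K) := Grading {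
  component :> G -> submodClosed V;
  grading_span : forall v : V, exists (s : seq G) (f : G -> V),
    (forall a, f a \in component a) /\ v = \sum_(a <- s) f a;
  grading_free : forall (s : seq G) (f : G -> V), uniq s ->
    (forall a, f a \in component a) -> \sum_(a <- s) f a = 0 ->
    forall a, a \in s -> f a = 0
}.

Record bicharacter (K : fieldType) (G : zmodType) (eps : G -> G -> K) : Prop :=
  Bicharacter {
  bichar_neq0 : forall a b, eps a b != 0;
  bicharC : forall a b, eps a b * eps b a = 1;
  bicharDr : forall a b c, eps a (b + c) = eps a b * eps a c;
  bicharDl : forall a b c, eps (a + b) c = eps a c * eps b c
}.

Definition trilinear (K : fieldType) (V : lmodType K) (t : V -> V -> V -> V)
  : Prop :=
  [/\ forall y z, linear (fun x => t x y z),
      forall x z, linear (fun y => t x y z)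
    & forall x y, linear (fun z => t x y z)].

Definition even2 (K : fieldType) (G : zmodType) (V : lmodType K)
    (V_ : grading G V) (br : V -> V -> V) : Prop :=
  forall a b x y, x \in V_ a -> y \in V_ b -> br x y \in V_ (a + b).

Definition even3 (K : fieldType) (G : zmodType) (V : lmodType K)
    (V_ : grading G V) (t : V -> V -> V -> V) : Prop :=
  forall a b c x y z, x \in V_ a -> y \in V_ b -> z \in V_ c ->
  t x y z \in V_ (a + b + c).

(* The identities below quantify over homogeneous elements together with a
   degree. A nonzero homogeneous element has exactly one degree; 0 has every
   degree, but each term is then 0 whatever the value of eps. *)

Record lie_color_algebra (K : fieldType) (G : zmodType) (A : lmodType K)
    (A_ : grading G A) (br : {bilinear A -> A -> A}) (eps : G -> G -> K)
  : Prop := LieColorAlgebra {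
  lca_bichar : bicharacter eps;
  lca_even : even2 A_ br;
  lca_skew : forall a b x y, x \in A_ a -> y \in A_ b ->
    br x y = - (eps a b *: br y x);
  lca_jacobi : forall a b c x y z, x \in A_ a -> y \in A_ b -> z \in A_ c ->
    eps c a *: br x (br y z) + eps a b *: br y (br z x)
      + eps b c *: br z (br x y) = 0
}.

Record color_lie_triple_system (K : fieldType) (G : zmodType) (A : lmodType K)
    (A_ : grading G A) (t : A -> A -> A -> A) (eps : G -> G -> K)
  : Prop := ColorLieTripleSystem {
  clts_bichar : bicharacter eps;
  clts_trilinear : trilinear t;
  clts_even : even3 A_ t;
  clts_fundamental : forall a b c d e x y z u v,
    x \in A_ a -> y \in A_ b -> z \in A_ c -> u \in A_ d -> v \in A_ e ->
    t (t x y z) u v = t x y (t z u v)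
      + eps c (d + e) *: t x (t y u v) z
      + eps (b + c) (d + e) *: t (t x u v) y z;
  clts_skew : forall a b c x y z, x \in A_ a -> y \in A_ b -> z \in A_ c ->
    t x y z = - (eps b c *: t x z y);
  clts_cyclic : forall a b c x y z, x \in A_ a -> y \in A_ b -> z \in A_ c ->
    eps c a *: t x y z + eps a b *: t y z x + eps b c *: t z x y = 0
}.

(* Main.v *)
Require Import Defs.
From HB Require Import structures.
From mathcomp Require Import all_boot all_order all_algebra.

Set Implicit Arguments.
Unset Strict Implicit.
Unset Printing Implicit Defensive.

Import GRing.Theory.
Local Open Scope ring_scope.

(** Skew-symmetry turns the color Jacobi identity into the statement that the
    right bracket by a homogeneous [w] is a color derivation of the bracket
    ([lca_derivation]).  The double bracket [x, [y, z]] is built from the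
    bracket alone, so a right bracket by [w] is also a color derivation of this
    ternary operation: it is enough to expand it twice, first over
    [x, [y, z]] and then over the inner [y, z].  Taking [w := [u, v]] is exactly
    the fundamental identity.  The two symmetry axioms need no such argument:
    the ternary skew-symmetry is that of the inner bracket, and the ternary
    cyclic identity is literally the color Jacobi identity. *)

(** In the Jacobi identity for [p, q, w], skew-symmetry moves [w] to the right
    in the last two terms; by [eps b c * eps c b = 1] and
    [eps a b * eps b a = 1] the three coefficients then share the invertible
    factor [eps c a]. *)
Lemma lca_derivation (K : fieldType) (G : zmodType) (A : lmodType K)
    (A_ : grading G A) (br : {bilinear A -> A -> A}) (eps : G -> G -> K) :
  lie_color_algebra A_ br eps -> forall a b c p q w,
  p \in A_ a -> q \in A_ b -> w \in A_ c ->
  br (br p q) w = br p (br q w) + eps b c *: br (br p w) q.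
Proof.
move=> lieA a b c p q w pa qb wc.
have [[eps0 epsC epsDr _] ev skew jac] := lieA.
have := jac _ _ _ _ _ _ pa qb wc.
rewrite (skew _ _ _ _ wc (ev _ _ _ _ pa qb)).
rewrite (skew _ _ _ _ wc pa) linearNr linearZr_LR /=.
rewrite (skew _ _ _ _ qb (ev _ _ _ _ pa wc)).
rewrite !scalerN opprK !scalerA !epsDr.
have -> : eps a b * eps c a * (eps b a * eps b c) = eps c a * eps b c.
  by rewrite mulrACA epsC mul1r.
have -> : eps b c * (eps c a * eps c b) = eps c a by rewrite mulrCA epsC mulr1.
rewrite -scalerA -scalerDr -scalerBr => /eqP.
by rewrite scaler_eq0 (negPf (eps0 _ _)) subr_eq0 => /eqP.
Qed.

Theorem theorem3p33 (K : fieldType) (char_neq2 : 2%N \notin [pchar K])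
    (G : zmodType) (A : lmodType K) (A_ : grading G A)
    (br : {bilinear A -> A -> A}) (eps : G -> G -> K)
    (lieA : lie_color_algebra A_ br eps) :
  color_lie_triple_system A_ (fun x y z => br x (br y z)) eps.
Proof.
have [bic ev skew jac] := lieA; split=> //.
- split=> [y z|x z|x y] k s t /=.
  + by rewrite linearPl.
  + by rewrite linearPl linearPr.
  + by rewrite !linearPr.
- move=> a b c x y z xa yb zc; rewrite -addrA.
  exact: ev xa (ev _ _ _ _ yb zc).
- move=> a b c d e x y z u v xa yb zc ud ve.
  have uv := ev _ _ _ _ ud ve.
  rewrite (lca_derivation lieA xa (ev _ _ _ _ yb zc) uv).
  by rewrite (lca_derivation lieA yb zc uv) linearDr linearZr_LR.
- move=> a b c x y z _ yb zc.
  by rewrite (skew _ _ _ _ yb zc) linearNr linearZr_LR.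
Qed.
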